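(* Let $\varphi_1,\dots,\varphi_d\in\mathcal{N}$ be orthonormal in $\mathcal{H}$. Then the image measure of the generalized Wright measure $\mu_\Psi$ on $\mathcal{N}'$ under the mapping $$\mathcal{N}'\ni\omega\mapsto(\langle\omega,\varphi_1\rangle,\dots,\langle\omega,\varphi_d\rangle)\in\mathbb{R}^d$$ is the finite-dimensional generalized Wright measure $\mu_\Psi^d$ on $\mathbb{R}^d$ (with the same parameters).
   Context: Parameters. $m,p\in\mathbb{N}_0=\{0,1,2,\dots\}$; $a_i\in\mathbb{R}$, $\alpha_i>0$, $a_i+\alpha_i>0$ for $i=1,\dots,p$; $b_j\in\mathbb{R}$, $\beta_j>0$, $b_j+\beta_j>0$ for $j=1,\dots,m$. Put $a^*:=\sum_{j=1}^m\beta_j-\sum_{i=1}^p\alpha_i$ and $\mu:=\sum_{j=1}^m b_j-\sum_{i=1}^p a_i+(p-m)/2$. It is assumed that either $a^*>0$, or $a^*=0$ and $\mu<-1$, and that the Fox-$H$ function $$H^{m,0}_{p,m}(\tau):=\frac{1}{2\pi\mathrm{i}}\int_{\gamma-\mathrm{i}\infty}^{\gamma+\mathrm{i}\infty}\frac{\prod_{j=1}^m\Gamma(b_j+\beta_js)}{\prod_{i=1}^p\Gamma(a_i+\alpha_is)}\,\tau^{-s}\,\mathrm{d}s,\qquad \tau>0,$$ is non-negative on $(0,\infty)$; here $\gamma\in(0,1)$ is such that all poles of the numerator lie to the left of the contour. Put $K:=\prod_{j=1}^m\Gamma(b_j+\beta_j)\big/\prod_{i=1}^p\Gamma(a_i+\alpha_i)$.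 Generalized Wright function. $\Psi$ is formally the power series $\Psi(z)=\sum_{k\ge0}\frac{\prod_{j=1}^m\Gamma(b_j+\beta_j(k+1))}{\prod_{i=1}^p\Gamma(a_i+\alpha_i(k+1))}\frac{z^k}{k!}$ (entire if $a^*<1$); in general, for $z>0$, $\Psi(-z)=\frac{1}{2\pi\mathrm{i}}\int_{\gamma-\mathrm{i}\infty}^{\gamma+\mathrm{i}\infty}\Gamma(s)\frac{\prod_{j=1}^m\Gamma(b_j+\beta_j-\beta_js)}{\prod_{i=1}^p\Gamma(a_i+\alpha_i-\alpha_is)}z^{-s}\,\mathrm{d}s$ with $0<\gamma<\min\{1,\min_j(b_j+\beta_j)/\beta_j\}$, and $\Psi(0)=K$. Nuclear triple. $\mathcal{H}$ is a real separable Hilbert space with inner product $(\cdot,\cdot)$ and norm $|\cdot|$; $\mathcal{N}=\bigcap_{l\in\mathbb{N}_0}\mathcal{H}_l$ is a nuclear space densely and continuously embedded in $\mathcal{H}$, the projective limit of real separable Hilbert spaces $\mathcal{H}_l$ with norms $|\cdot|_l$, $\mathcal{H}_0=\mathcal{H}$, $|\cdot|_l\le|\cdot|_{l+1}$, all inclusions $\mathcal{H}_{l+1}\subset\mathcal{H}_l$ being Hilbert–Schmidt. $\mathcal{N}'$ is its dual, $\mathcal{N}\subset\mathcal{H}\subset\mathcal{N}'$, with dual pairing $\langle\cdot,\cdot\rangle$ extending the inner product of $\mathcal{H}$, and $\mathcal{C}_\sigma(\mathcal{N}')$ is the cylindrical $\sigma$-algebra. Measures. The generalized Wright measure $\mu_\Psi$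 is the unique probability measure on $(\mathcal{N}',\mathcal{C}_\sigma(\mathcal{N}'))$ with $\int_{\mathcal{N}'}\mathrm{e}^{\mathrm{i}\langle\omega,\varphi\rangle}\,\mathrm{d}\mu_\Psi(\omega)=\frac1K\Psi\big(-\tfrac{\langle\varphi,\varphi\rangle}{2}\big)$, $\varphi\in\mathcal{N}$. The measure $\mu_\Psi^d$ is the unique probability measure on $\mathbb{R}^d$ with $\int_{\mathbb{R}^d}\mathrm{e}^{\mathrm{i}(y,x)}\,\mathrm{d}\mu_\Psi^d(x)=\frac1K\Psi\big(-\tfrac{(y,y)}{2}\big)$, $y\in\mathbb{R}^d$ (Euclidean inner product). *)

(* Defs.v *)
From HB Require Import structures.
From mathcomp Require Import all_boot all_order all_algebra.
From mathcomp Require Import all_classical all_reals all_analysis.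
From mathcomp Require Import complex.

Set Implicit Arguments.
Unset Strict Implicit.
Unset Printing Implicit Defensive.

Import Order.TTheory GRing.Theory Num.Theory.
Import numFieldNormedType.Exports.

Local Open Scope classical_set_scope.
Local Open Scope ring_scope.
Local Open Scope complex_scope.

Section ComplexAnalysis.
Context {R : realType}.

Definition expC (z : R[i]) : R[i] :=
  (expR (complex.Re z))%:C * (cos (complex.Im z) +i* sin (complex.Im z)).

(* [t ^ z] for real [t > 0]. *)
Definition powC (t : R) (z : R[i]) : R[i] := expC (z * (ln t)%:C).

Definition integralC d (T : measurableType d) (mu : {measure set T -> \bar R})
    (D : set T) (f : T -> R[i]) : R[i] :=
  (\int[mu]_(x in D) complex.Re (f x)) +i*
  (\int[mu]_(x in D) complex.Im (f x)).

(* Euler's integral, to be used for [0 < Re z] only. *)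
Definition Gamma_euler (z : R[i]) : R[i] :=
  integralC lebesgue_measure `]0, +oo[%classic
    (fun t : R => powC t (z - 1) * (expR (- t))%:C).

(* The meromorphic continuation of Euler's integral through
   [Gamma (z + n) = z (z + 1) ... (z + n - 1) Gamma z].
   At the poles 0, -1, -2, ... one factor vanishes and division by zero gives
   [Gamma z = 0], so that [(Gamma z)^-1 = 0] there too: [(Gamma z)^-1] is the
   entire reciprocal Gamma function everywhere. *)
Definition Gamma (z : R[i]) : R[i] :=
  let n := if 0 < complex.Re z then 0%N
           else (Num.truncn (- complex.Re z)).+1 in
  Gamma_euler (z + n%:R) / \prod_(k < n) (z + k%:R).

(* [\int_(gamma - i oo)^(gamma + i oo) f(s) ds], with [ds = i dt]. *)
Definition vline_integral (gamma : R) (f : R[i] -> R[i]) : R[i] :=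
  'i * integralC lebesgue_measure setT (fun t : R => f (gamma +i* t)).

End ComplexAnalysis.

Section FoxWright.
Context {R : realType} {p m : nat}.
Variables (a alpha : 'I_p -> R) (b beta : 'I_m -> R).

Definition fox_astar : R := \sum_(j < m) beta j - \sum_(i < p) alpha i.

Definition fox_mu : R :=
  \sum_(j < m) b j - \sum_(i < p) a i + (p%:R - m%:R) / 2.

(* The poles of the numerator [\prod_j Gamma (b_j + beta_j s)] are the points
   [- (b_j + k) / beta_j] with [k] a natural number. *)
Definition foxH_abscissa (gamma : R) : Prop :=
  0 < gamma < 1 /\ forall (j : 'I_m) (k : nat), - (b j + k%:R) / beta j < gamma.

Definition foxH (gamma : R) (tau : R) : R[i] :=
  (2 * pi%:C * 'i)^-1 * vline_integral gamma (fun s : R[i] =>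
    \prod_(j < m) Gamma ((b j)%:C + (beta j)%:C * s) /
    \prod_(i < p) Gamma ((a i)%:C + (alpha i)%:C * s) * powC tau (- s)).

Definition wrightK : R[i] :=
  \prod_(j < m) Gamma (b j + beta j)%:C /
  \prod_(i < p) Gamma (a i + alpha i)%:C.

Definition wright_abscissa (gamma : R) : Prop :=
  0 < gamma < 1 /\ forall j : 'I_m, gamma < (b j + beta j) / beta j.

(* [Psi x] for [x <= 0]; the contour integral is the one of [Psi (- z)] with
   [z = - x]. *)
Definition wrightPsi (gamma : R) (x : R) : R[i] :=
  if x == 0 then wrightK else
  (2 * pi%:C * 'i)^-1 * vline_integral gamma (fun s : R[i] =>
    Gamma s *
    (\prod_(j < m) Gamma ((b j + beta j)%:C - (beta j)%:C * s) /
     \prod_(i < p) Gamma ((a i + alpha i)%:C - (alpha i)%:C * s)) *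
    powC (- x) (- s)).

End FoxWright.

Section Hilbert.
Context {R : realType}.

Record hilbertType := HilbertType {
  hilbert_sort :> completeNormedModType R ;
  inner : {dot hilbert_sort for idfun} ;
  inner_norm : forall x : hilbert_sort, inner x x = `|x| ^+ 2
}.

Definition separable (T : topologicalType) : Prop :=
  exists2 D : set T, countable D & dense D.

Definition linear_span (V : lmodType R) (E : set V) : set V :=
  [set x | exists n (c : 'I_n -> R) (e : 'I_n -> V),
    (forall k, E (e k)) /\ x = \sum_(k < n) c k *: e k].

Definition orthonormal_basis (H : hilbertType) (E : set H) : Prop :=
  (forall x y, E x -> E y -> inner H x y = (x == y)%:R) /\
  dense (linear_span E).

Definition hilbert_schmidt (H1 H2 : hilbertType) (T : {linear H1 -> H2}) :
    Prop :=
  continuous T /\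
  exists E : set H1, orthonormal_basis E /\
    (\esum_(e in E) (`|T e| ^+ 2)%:E < +oo)%E.

End Hilbert.
Arguments hilbertType : clear implicits.

(* The inclusions [H_(l+1) `<=` H_l] and [N `<=` H_l] are injective linear
   maps; [nt_lim] says that [N] is the whole intersection of the [H_l], i.e.
   their projective limit. *)
Record nuclear_triple (R : realType) := NuclearTriple {
  nt_H : nat -> hilbertType R ;
  nt_separable : forall l, separable (nt_H l) ;
  nt_incl : forall l, {linear nt_H l.+1 -> nt_H l} ;
  nt_incl_inj : forall l, injective (nt_incl l) ;
  nt_norm_le : forall l (x : nt_H l.+1), `|nt_incl l x| <= `|x| ;
  nt_hilbert_schmidt : forall l, hilbert_schmidt (nt_incl l) ;
  nt_N :> lmodType R ;
  nt_emb : forall l, {linear nt_N -> nt_H l} ;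
  nt_emb_inj : forall l, injective (nt_emb l) ;
  nt_emb_compat : forall l phi, nt_incl l (nt_emb l.+1 phi) = nt_emb l phi ;
  nt_lim : forall x : (forall l, nt_H l),
    (forall l, nt_incl l (x l.+1) = x l) ->
    exists phi, forall l, nt_emb l phi = x l ;
  nt_dense : dense (range (nt_emb 0))
}.

Section NuclearTriple.
Context {R : realType} (N : nuclear_triple R).

(* The coarsest topology making every embedding [N -> H_l] continuous. *)
Definition proj_lim_topology : topologicalType :=
  sup_topology (fun l => Topological.class (initial_topology (nt_emb N l))).

(* The inner product of [H = H_0] on [N]. *)
Definition innerN (phi psi : N) : R :=
  inner (nt_H N 0) (nt_emb N 0 phi) (nt_emb N 0 psi).

(* The dual space [N']; the pairing [<omega, phi>] is [omega phi]. *)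
Record dual := Dual {
  dual_fun :> {linear N -> R^o} ;
  dual_continuous : continuous (dual_fun : proj_lim_topology -> R)
}.

Lemma dual0_continuous :
  continuous ((\0 : {linear N -> R^o}) : proj_lim_topology -> R).
Proof. by move=> x; exact: (@cst_continuous proj_lim_topology R 0). Qed.

HB.instance Definition _ := gen_eqMixin dual.
HB.instance Definition _ := gen_choiceMixin dual.
HB.instance Definition _ := isPointed.Build dual (Dual dual0_continuous).

Definition pairings d (phi : 'I_d -> N) (omega : dual) : d.-tuple R :=
  [tuple omega (phi i) | i < d].

Definition cylinders : set (set dual) :=
  [set A | exists d (phi : 'I_d -> N) (B : set (d.-tuple R)),
    measurable B /\ A = pairings phi @^-1` B].

(* [N'] with its cylindrical sigma-algebra. *)
Definition dual_cyl := g_sigma_algebraType cylinders.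

HB.instance Definition _ := Measurable.on dual_cyl.

Definition pairings_cyl d (phi : 'I_d -> N) : dual_cyl -> d.-tuple R :=
  pairings phi.

Lemma measurable_pairings d (phi : 'I_d -> N) :
  measurable_fun [set: dual_cyl] (pairings_cyl phi).
Proof.
move=> _ B mB; rewrite setTI; apply: sub_sigma_algebra.
by exists d, phi, B.
Qed.

HB.instance Definition _ d (phi : 'I_d -> N) :=
  isMeasurableFun.Build _ _ _ _ (pairings_cyl phi) (measurable_pairings phi).

End NuclearTriple.

Section WrightMeasures.
Context {R : realType} {p m : nat}.
Variables (a alpha : 'I_p -> R) (b beta : 'I_m -> R) (gamma : R).

(* The property that characterizes [mu_Psi] among the probability measures on
   [N']; that at most one measure has it is not part of the predicate. *)
Definition is_wright_measure (N : nuclear_triple R)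
    (mu : probability (dual_cyl N) R) : Prop :=
  forall phi : N,
    integralC mu setT (fun omega : dual N => expC ('i * (omega phi)%:C)) =
    (wrightK a alpha b beta)^-1 *
    wrightPsi a alpha b beta gamma (- (innerN phi phi / 2)).

Definition dotR d (y x : d.-tuple R) : R :=
  \sum_(i < d) tnth y i * tnth x i.

(* The property that characterizes [mu_Psi^d] among the probability measures
   on [R^d], here [d.-tuple R], whose measurable sets are generated by the
   coordinates, i.e. are the Borel sets; uniqueness is again not part of the
   predicate. *)
Definition is_wright_measure_fd d (nu : probability (d.-tuple R) R) : Prop :=
  forall y : d.-tuple R,
    integralC nu setT (fun x : d.-tuple R => expC ('i * (dotR y x)%:C)) =
    (wrightK a alpha b beta)^-1 *
    wrightPsi a alpha b beta gamma (- (dotR y y / 2)).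

End WrightMeasures.

(* Main.v *)
Require Import Defs.
From HB Require Import structures.
From mathcomp Require Import all_boot all_order all_algebra.
From mathcomp Require Import all_classical all_reals all_analysis.
From mathcomp Require Import measurable_realfun.
From mathcomp Require Import complex.
From mathcomp Require Import ring lra.
Import Order.TTheory GRing.Theory Num.Theory.
Import numFieldNormedType.Exports.
Local Open Scope classical_set_scope.
Local Open Scope ring_scope.

Set Implicit Arguments.
Unset Strict Implicit.
Unset Printing Implicit Defensive.

(** The image measure has the right characteristic function by linearity: for
[y] in [R^d] the form [(y, x)] evaluated at [x = (<omega, phi_i>)_i] is
[<omega, psi>] with [psi = \sum_i y_i phi_i], so a change of variables turns
the characteristic function of the image at [y] into that of [mu] at [psi], and
orthonormality gives [<psi, psi> = (y, y)] ([dotR_pairings],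
[innerN_orthonormal]).

The identification of the image with any other measure having this
characteristic function is the uniqueness theorem for Fourier transforms of
probability measures on [R^d] ([char_fun_unique]).  Let [P] and
[Q] have the same characteristic function.  Call a bounded measurable [g] a
multiplier if, whenever [f P] and [f Q] have equal Fourier transforms for a
bounded measurable [f], so do [f g P] and [f g Q].  Multipliers form an algebra,
closed under uniformly bounded pointwise limits (dominated convergence), and it
contains every [cos ((z, x) + t)], because
[cos A cos B = (cos (A + B) + cos (A - B)) / 2].  Now
- polynomials that are bounded on [[0, 1]] and converge pointwise to the
  indicator of [[0, 1/2[] ([cvg_step_poly]) turn a multiplier [g] with values
  in [[-1, 1]] into the indicator of [g > 0] ([multiplier_pos]);
- applied to [sin (r (x_i - c))], with [r] tending to 0, this yields the
  indicator of the half-space [x_i > c] ([multiplier_ray]);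
- the sets whose indicator is a multiplier form a sigma-algebra, by the algebra
  and limit properties ([multiplier_sigma_algebra]), so every measurable set is
  among them.
Multiplying the constant function 1 by the indicator of [A] and evaluating the
Fourier transforms at 0 gives [P A = Q A]. *)

(** * Polynomials approximating a step function *)

Lemma bernoulli_ineq (R : realDomainType) (x : R) (n : nat) :
  -1 <= x -> 1 + n%:R * x <= (1 + x) ^+ n.
Proof.
move=> x_ge; elim: n => [|n IH]; first by rewrite mul0r addr0 expr0.
have /(ler_wpM2r (_ : 0 <= 1 + x)) : 1 + n%:R * x <= (1 + x) ^+ n by [].
rewrite -exprSr => /(_ ltac:(lra)); apply: le_trans.
by rewrite -natr1; have := mulr_ge0 (ler0n R n) (sqr_ge0 x); lra.
Qed.

(** [(1 - x)(1 + x) <= 1] moves Bernoulli's inequality to the denominator. *)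
Lemma exprn_onem_ub (R : realFieldType) (x : R) (n : nat) :
  0 <= x <= 1 -> (1 - x) ^+ n <= (1 + n%:R * x)^-1.
Proof.
move=> /andP[x0 x1]; have nx0 : 0 < 1 + n%:R * x.
  by rewrite ltr_wpDr// mulr_ge0.
rewrite -div1r ler_pdivlMr//.
apply: (@le_trans _ _ ((1 - x) ^+ n * (1 + x) ^+ n)).
  by apply: ler_wpM2l; [apply: exprn_ge0; lra | apply: bernoulli_ineq; lra].
by rewrite -exprMn exprn_ile1//; nra.
Qed.

Lemma step_poly_bound (R : realFieldType) (u : R) (n : nat) : 0 <= u <= 1 ->
  0 <= (1 - u ^+ n.*2) ^+ (n * 4 ^ n) <= 1.
Proof.
move=> /andP[u0 u1]; have v0 : 0 <= u ^+ n.*2 by exact: exprn_ge0.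
have v1 : u ^+ n.*2 <= 1 by exact: exprn_ile1.
by rewrite exprn_ge0 ?exprn_ile1//; lra.
Qed.

(** By Bernoulli's inequality the value lies between [1 - n (2 u)^(2 n)] and
[1 / (1 + n (2 u)^(2 n))].  The factor [n] in front of [4 ^ n] forces the limit
0 at [u = 1/2] as well, where the exponent [4 ^ n] alone would give the limit
[exp (- 1)]. *)
Lemma cvg_step_poly (R : realType) (u : R) : 0 <= u <= 1 ->
  (1 - u ^+ n.*2) ^+ (n * 4 ^ n) @[n --> \oo] --> ((u < 2^-1)%R%:R : R).
Proof.
move=> u01; have /andP[u0 u1] := u01.
have cvgV : (n%:R^-1 : R) @[n --> \oo] --> (0 : R).
  by apply/gtr0_cvgV0; [near=> n; rewrite ltr0n; near: n; exact: nbhs_infty_gt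
    | exact: cvgr_idn].
have natE n : (n * 4 ^ n)%:R * u ^+ n.*2 = n%:R * ((2 * u) ^+ n) ^+ 2.
  by rewrite natrM natrX -mul2n exprM -mulrA -exprMn -exprM mulnC exprM;
    congr (_ * _ ^+ _); ring.
have vle1 n : 0 <= u ^+ n.*2 <= 1 by rewrite exprn_ge0// exprn_ile1.
case: ltP => hu /=.
- have [->|un0] := eqVneq u 0.
    apply: cvg_near_cst; near=> n.
    have n0 : (0 < n)%N by near: n; exact: nbhs_infty_gt.
    by rewrite expr0n double_eq0 eqn0Ngt n0 subr0 expr1n.
  have {un0}up : 0 < u by rewrite lt_def un0.
  (* [(2 u)^n <= 1 / (n h)], whence [n (2 u)^(2 n) <= 1 / (n h^2)] *)
  have [h h0 hE] : exists2 h, 0 < h & (2 * u)^-1 = 1 + h.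
    by exists ((2 * u)^-1 - 1); [rewrite subr_gt0 invf_gt1; lra | lra].
  have vh n : (0 < n)%N -> (2 * u) ^+ n <= (n%:R * h)^-1.
    move=> n0; have nh : 0 < n%:R * h by rewrite mulr_gt0// ltr0n.
    rewrite -[leLHS]invrK lef_pV2 ?posrE ?invr_gt0 ?exprn_gt0//; last lra.
    rewrite -exprVn hE.
    by apply: le_trans (@bernoulli_ineq _ h n _); lra.
  apply: (@squeeze_cvgr _ _ _ _ (fun n => 1 - n%:R^-1 * (h ^- 2)) (cst 1)).
  + near=> n; have n0 : (0 < n)%N by near: n; exact: nbhs_infty_gt.
    have /andP[_ ->] := @step_poly_bound _ u n u01; rewrite andbT.
    have /andP[v0 v1] := vle1 n.
    have := @bernoulli_ineq _ (- u ^+ n.*2) (n * 4 ^ n).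
    rewrite mulrN natE => /(_ ltac:(lra)); apply: le_trans.
    rewrite lerB//; apply: (@le_trans _ _ (n%:R * (n%:R * h)^-1 ^+ 2)).
      rewrite ler_wpM2l// lerXn2r ?nnegrE ?vh ?exprn_ge0 ?invr_ge0//.
      - by lra.
      - by rewrite mulr_ge0// ltW.
    have n0' : n%:R != 0 :> R by rewrite pnatr_eq0 -lt0n.
    have hn0 : h != 0 by rewrite gt_eqF.
    rewrite le_eqVlt; apply/orP; left; apply/eqP.
    field.
    by rewrite n0' hn0.
  + rewrite -[X in _ --> X]subr0; apply: cvgB; first exact: cvg_cst.
    by rewrite -[X in _ --> X](mul0r (h ^- 2)); apply: cvgM => //; exact: cvg_cst.
  + exact: cvg_cst.
- apply: (@squeeze_cvgr _ _ _ _ (cst 0) (fun n => n%:R^-1)) => //;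
    last exact: cvg_cst.
  near=> n; have n0 : (0 < n)%N by near: n; exact: nbhs_infty_gt.
  have /andP[-> _] /= := @step_poly_bound _ u n u01.
  apply: le_trans (@exprn_onem_ub _ _ (n * 4 ^ n)%N (vle1 n)) _.
  rewrite natE lef_pV2 ?posrE ?ltr0n//; last first.
    by rewrite ltr_pwDl// mulr_ge0// sqr_ge0.
  have : 1 <= ((2 * u) ^+ n) ^+ 2.
    by rewrite !exprn_ege1//; lra.
  have : 0 < n%:R :> R by rewrite ltr0n.
  nra.
Unshelve. all: by end_near. Qed.

(** * Bounded measurable functions *)

Section BoundedMeasurable.
Context {disp : measure_display} {T : measurableType disp} {R : realType}.
Implicit Types (f g : T -> R) (P : probability T R).

Definition bounded_measurable f : Prop :=
  measurable_fun setT f /\ exists C, forall x, `|f x| <= C.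

Lemma bounded_measurable_integrable P f :
  bounded_measurable f -> P.-integrable setT (EFin \o f).
Proof.
move=> [mf [C fC]]; apply: measurable_bounded_integrable => //.
  exact: le_lt_trans (probability_le1 P measurableT) (ltry _).
by exists C; split=> [|M CM x _]; [exact: num_real|exact/(le_trans (fC x))/ltW].
Qed.

Lemma bounded_measurable_cst (c : R) : bounded_measurable (cst c).
Proof. by split; [exact: measurable_cst | exists `|c|]. Qed.

Lemma bounded_measurableD f g : bounded_measurable f -> bounded_measurable g ->
  bounded_measurable (f \+ g).
Proof.
move=> [mf [C fC]] [mg [D gD]]; split; first exact: measurable_funD.
by exists (C + D) => x; rewrite (le_trans (ler_normD _ _))// lerD.
Qed.

Lemma bounded_measurableM f g : bounded_measurable f -> bounded_measurable g ->
  bounded_measurable (f \* g).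
Proof.
move=> [mf [C fC]] [mg [D gD]]; split; first exact: measurable_funM.
by exists (C * D) => x; rewrite normrM ler_pM.
Qed.

Lemma bounded_measurable_cvg (f_ : nat -> T -> R) f (C : R) :
  (forall n, bounded_measurable (f_ n)) -> (forall n x, `|f_ n x| <= C) ->
  (forall x, f_ n x @[n --> \oo] --> f x) -> bounded_measurable f.
Proof.
move=> mf_ f_C f_f; split.
  by apply: (@measurable_fun_cvg _ _ _ setT f_) => [n|x _];
    [case: (mf_ n) | exact: f_f].
exists C => x; have f_fx : `|f_ n x| @[n --> \oo] --> `|f x|.
  by apply: cvg_norm; exact: f_f.
rewrite -(cvg_lim _ f_fx)//; apply: limr_le; first by apply/cvg_ex; exists `|f x|.
by apply: nearW => n; exact: f_C.
Qed.

Lemma bounded_Rintegral_cvg P (f_ : nat -> T -> R) f (C : R) :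
  (forall n, bounded_measurable (f_ n)) -> (forall n x, `|f_ n x| <= C) ->
  (forall x, f_ n x @[n --> \oo] --> f x) ->
  \int[P]_x f_ n x @[n --> \oo] --> \int[P]_x f x.
Proof.
move=> mf_ f_C f_f.
have mf := bounded_measurable_cvg mf_ f_C f_f.
have fin g : bounded_measurable g -> (\int[P]_x (g x)%:E)%E \is a fin_num.
  by move=> mg; apply: integrable_fin_num (bounded_measurable_integrable P mg).
apply: (@fine_cvg _ _ _ _ (fun n => \int[P]_x (f_ n x)%:E)%E).
rewrite /Rintegral fineK; last exact: fin.
have mEf_ n : measurable_fun setT (EFin \o f_ n).
  by case: (mf_ n) => mfn _; exact/measurable_EFinP.
have mEf : measurable_fun setT (EFin \o f).
  by case: mf => mf _; exact/measurable_EFinP.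
have [] := @dominated_convergence _ _ _ P setT measurableT
  (fun n => EFin \o f_ n) (EFin \o f) (cst C%:E) mEf_ mEf => //.
- by apply: aeW => x _; apply: cvg_EFin; [exact: nearW | exact: f_f].
- exact/bounded_measurable_integrable/bounded_measurable_cst.
- by apply: aeW => x n _; rewrite /= lee_fin.
Qed.

End BoundedMeasurable.

(** * Multipliers of Fourier transforms *)

Section CharacteristicFunction.
Context {R : realType} {d : nat} (P Q : probability (d.-tuple R) R).
Implicit Types (f g : d.-tuple R -> R) (y z x : d.-tuple R).

Lemma measurable_dotR z : measurable_fun setT (@dotR R d z).
Proof.
apply: (@measurable_sum _ _ _ _ _ _ (fun i x => tnth z i * tnth x i)) => i.
apply: measurable_funM; [exact: measurable_cst | exact: measurable_tnth].
Qed.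

Lemma bounded_measurable_cos z (t : R) :
  bounded_measurable (fun x => cos (dotR z x + t)).
Proof.
split; last by exists 1 => x; rewrite ler_norml cos_geN1 cos_le1.
apply: measurableT_comp; first by apply: continuous_measurable_fun; exact: continuous_cos.
by apply: measurable_funD; [exact: measurable_dotR | exact: measurable_cst].
Qed.

(** The measures with densities [f] with respect to [P] and [Q] have the same
Fourier transform.  The phase [t] covers the real part ([t = 0]) and the
imaginary part ([t = - pi / 2]) by one real integral. *)
Definition same_fourier f : Prop := bounded_measurable f /\
  forall z (t : R), \int[P]_x (f x * cos (dotR z x + t)) =
                    \int[Q]_x (f x * cos (dotR z x + t)).

(** Unlike the functions with [same_fourier], which form only a vector space,
multipliers are closed under products. *)
Definition multiplier g : Prop :=
  bounded_measurable g /\ forall f, same_fourier f -> same_fourier (f \* g).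

Lemma same_fourierD f g :
  same_fourier f -> same_fourier g -> same_fourier (f \+ g).
Proof.
move=> [bf ff] [bg fg]; split=> [|z t]; first exact: bounded_measurableD.
have int h (S : probability (d.-tuple R) R) : bounded_measurable h ->
    S.-integrable setT (EFin \o (fun x => h x * cos (dotR z x + t))).
  move=> bh; apply: bounded_measurable_integrable.
  exact: bounded_measurableM (bounded_measurable_cos z t).
under eq_Rintegral do rewrite mulrDl.
under [in RHS]eq_Rintegral do rewrite mulrDl.
by rewrite !RintegralD//; [rewrite ff fg | exact: int..].
Qed.

Lemma same_fourierZ (c : R) f : same_fourier f -> same_fourier (fun x => c * f x).
Proof.
move=> [bf ff]; split=> [|z t].
  exact: bounded_measurableM (bounded_measurable_cst c) bf.
have int (S : probability (d.-tuple R) R) :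
    S.-integrable setT (EFin \o (fun x => f x * cos (dotR z x + t))).
  apply: bounded_measurable_integrable.
  exact: bounded_measurableM (bounded_measurable_cos z t).
under eq_Rintegral do rewrite -mulrA.
under [in RHS]eq_Rintegral do rewrite -mulrA.
by rewrite !RintegralZl//; [rewrite ff | exact: int..].
Qed.

Lemma same_fourier_cvg (f_ : nat -> d.-tuple R -> R) f (C : R) :
  (forall n, same_fourier (f_ n)) -> (forall n x, `|f_ n x| <= C) ->
  (forall x, f_ n x @[n --> \oo] --> f x) -> same_fourier f.
Proof.
move=> ff_ f_C f_f; have bf_ n : bounded_measurable (f_ n) by case: (ff_ n).
split=> [|z t]; first exact: bounded_measurable_cvg bf_ f_C f_f.
have cvgS (S : probability (d.-tuple R) R) :
    \int[S]_x (f_ n x * cos (dotR z x + t)) @[n --> \oo] -->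
    \int[S]_x (f x * cos (dotR z x + t)).
  apply: (@bounded_Rintegral_cvg _ _ _ S _ _ C) => [n|n x|x].
  - exact: bounded_measurableM (bounded_measurable_cos z t).
  - rewrite normrM -[leRHS]mulr1 ler_pM//.
    by rewrite ler_norml cos_geN1 cos_le1.
  - by apply: cvgM; [exact: f_f | exact: cvg_cst].
have PQ : (fun n => \int[P]_x (f_ n x * cos (dotR z x + t))) =
          (fun n => \int[Q]_x (f_ n x * cos (dotR z x + t))).
  by apply/funext => n; rewrite (ff_ n).2.
by apply: (cvg_unique _ (cvgS P)) => //; rewrite PQ; exact: cvgS.
Qed.

Lemma multiplier_cst (c : R) : multiplier (cst c).
Proof.
split=> [|f ff]; first exact: bounded_measurable_cst.
rewrite (_ : f \* _ = fun x => c * f x); first exact: same_fourierZ.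
by rewrite funeqE => x /=; exact: mulrC.
Qed.

Lemma multiplierD f g : multiplier f -> multiplier g -> multiplier (f \+ g).
Proof.
move=> [bf mf] [bg mg]; split=> [|h fh]; first exact: bounded_measurableD.
rewrite (_ : h \* _ = (h \* f) \+ (h \* g)); last first.
  by rewrite funeqE => x /=; exact: mulrDr.
by apply: same_fourierD; [exact: mf | exact: mg].
Qed.

Lemma multiplierM f g : multiplier f -> multiplier g -> multiplier (f \* g).
Proof.
move=> [bf mf] [bg mg]; split=> [|h fh]; first exact: bounded_measurableM.
rewrite (_ : h \* _ = (h \* f) \* g); last first.
  by rewrite funeqE => x /=; exact: mulrA.
by apply: mg; exact: mf.
Qed.

Lemma multiplierX g n : multiplier g -> multiplier (fun x => g x ^+ n).
Proof.
move=> mg; elim: n => [|n IH]; first exact: (multiplier_cst 1).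
rewrite (_ : (fun x => _) = (fun x => g x ^+ n) \* g); first exact: multiplierM.
by rewrite funeqE => x /=; rewrite exprSr.
Qed.

Lemma multiplier_affine (a b : R) g :
  multiplier g -> multiplier (fun x => a + b * g x).
Proof.
move=> mg; apply: (@multiplierD (cst a)); first exact: multiplier_cst.
exact: (multiplierM (multiplier_cst b)).
Qed.

Lemma multiplier_cvg (g_ : nat -> d.-tuple R -> R) g (C : R) :
  (forall n, multiplier (g_ n)) -> (forall n x, `|g_ n x| <= C) ->
  (forall x, g_ n x @[n --> \oo] --> g x) -> multiplier g.
Proof.
move=> mg_ g_C g_g; split=> [|f ff].
  by apply: bounded_measurable_cvg g_C g_g => n; case: (mg_ n).
have [[_ [D fD]] _] := ff.
apply: (@same_fourier_cvg (fun n => f \* g_ n) _ (D * C)) => [n|n x|x].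
- by case: (mg_ n) => _; exact.
- by rewrite normrM ler_pM.
- by apply: cvgM; [exact: cvg_cst | exact: g_g].
Qed.

(** The product formula for two cosines writes the Fourier transform at [y] of
[f] times this function as a combination of those of [f] at [z + y] and
[z - y]. *)
Lemma multiplier_cos z (t : R) : multiplier (fun x => cos (dotR z x + t)).
Proof.
split=> [|f ff]; first exact: bounded_measurable_cos.
have [bf If] := ff.
split=> [|y s]; first exact: bounded_measurableM (bounded_measurable_cos z t).
pose zy : d.-tuple R := [tuple tnth z i + tnth y i | i < d].
pose zBy : d.-tuple R := [tuple tnth z i - tnth y i | i < d].
have dotD x : dotR zy x = dotR z x + dotR y x.
  by rewrite -big_split; apply: eq_bigr => i _; rewrite tnth_mktuple mulrDl.
have dotB x : dotR zBy x = dotR z x - dotR y x.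
  by rewrite -sumrB; apply: eq_bigr => i _; rewrite tnth_mktuple mulrBl.
have E x : f x * cos (dotR z x + t) * cos (dotR y x + s) =
    2^-1 * (f x * cos (dotR zy x + (t + s)) + f x * cos (dotR zBy x + (t - s))).
  rewrite dotD dotB (_ : _ + (t + s) = (dotR z x + t) + (dotR y x + s)); last ring.
  rewrite (_ : _ + (t - s) = (dotR z x + t) - (dotR y x + s)); last ring.
  by rewrite (cosD (dotR z x + t)) (cosB (dotR z x + t)); field.
have int (S : probability (d.-tuple R) R) w r :
    S.-integrable setT (EFin \o (fun x => f x * cos (dotR w x + r))).
  apply: bounded_measurable_integrable.
  exact: bounded_measurableM (bounded_measurable_cos w r).
under eq_Rintegral do rewrite E.
under [in RHS]eq_Rintegral do rewrite E.
have intD (S : probability (d.-tuple R) R) : S.-integrable setT (EFin \o (fun x =>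
    f x * cos (dotR zy x + (t + s)) + f x * cos (dotR zBy x + (t - s)))).
  by have := integrableD measurableT (int S zy (t + s)) (int S zBy (t - s)).
rewrite !RintegralZl; do ?[exact: intD | exact: measurableT].
by rewrite !RintegralD; do ?[exact: int | exact: measurableT]; rewrite !If.
Qed.

Lemma dotR_delta (i : 'I_d) (r : R) x :
  dotR [tuple r *+ (j == i) | j < d] x = r * tnth x i.
Proof.
rewrite /dotR (bigD1 i)//= tnth_mktuple eqxx mulr1n big1 ?addr0// => j ji.
by rewrite tnth_mktuple (negbTE ji) mulr0n mul0r.
Qed.

(** A sine is a cosine with its phase shifted by [- pi / 2]. *)
Lemma multiplier_sin (i : 'I_d) (r c : R) :
  multiplier (fun x => sin (r * (tnth x i - c))).
Proof.
rewrite (_ : (fun x => _) = (fun x =>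
  cos (dotR [tuple r *+ (j == i) | j < d] x + (- (r * c) - pi / 2)))).
  exact: multiplier_cos.
rewrite funeqE => x; rewrite dotR_delta addrA -mulrBr.
by rewrite cosB cos_pihalf sin_pihalf mulr0 mulr1 add0r.
Qed.

(** [u = (1 - g) / 2] maps [[-1, 1]] to [[0, 1]], with [u < 1/2] exactly where
[g > 0]; the step polynomials in [u] are multipliers. *)
Lemma multiplier_pos g : (forall x, -1 <= g x <= 1) ->
  multiplier g -> multiplier (\1_[set x | 0 < g x] : _ -> R).
Proof.
move=> g1 mg; pose u x := 2^-1 + (- 2^-1) * g x.
have u01 x : 0 <= u x <= 1 by have := g1 x; rewrite /u; lra.
apply: (@multiplier_cvg (fun n x => (1 - u x ^+ n.*2) ^+ (n * 4 ^ n)) _ 1).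
- move=> n; apply: multiplierX.
  rewrite (_ : (fun x => _) = (fun x => 1 + (-1) * u x ^+ n.*2)).
    exact/multiplier_affine/multiplierX/multiplier_affine.
  by rewrite funeqE => x; rewrite mulN1r.
- move=> n x; have /andP[v0 v1] := step_poly_bound n (u01 x).
  by rewrite ger0_norm.
- move=> x; rewrite indicE (_ : x \in _ = (u x < 2^-1)).
    exact: cvg_step_poly.
  by apply/idP/idP; rewrite inE /= /u; lra.
Qed.

(** Once [|r (x_i - c)| < pi], the sign of [sin (r (x_i - c))] is that of
[x_i - c]; for every [x] this holds as soon as [r = 1 / (n + 1)] is small. *)
Lemma multiplier_ray (i : 'I_d) (c : R) :
  multiplier (\1_[set x : d.-tuple R | c < tnth x i] : _ -> R).
Proof.
pose g n x : R := sin (n.+1%:R^-1 * (tnth x i - c)).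
apply: (@multiplier_cvg (fun n => \1_[set x | 0 < g n x]) _ 1).
- move=> n; apply: multiplier_pos => [x|]; last exact: multiplier_sin.
  by rewrite sin_geN1 sin_le1.
- by move=> n x; rewrite indicE ger0_norm// lern1 leq_b1.
move=> x; apply: cvg_near_cst; near=> n; rewrite !indicE; congr (nat_of_bool _)%:R.
have n0 : 0 < n.+1%:R^-1 :> R by rewrite invr_gt0.
have small : `|n.+1%:R^-1 * (tnth x i - c)| < pi.
  rewrite normrM (gtr0_norm n0) mulrC ltr_pdivrMr ?ltr0Sn//.
  rewrite mulrC -ltr_pdivrMr ?pi_gt0// -natr1.
  have : `|tnth x i - c| / pi <= n%:R by near: n; exact: nbhs_infty_ger.
  by move/le_lt_trans; apply; rewrite ltrDl.
have sgE : (c < tnth x i) = (0 < n.+1%:R^-1 * (tnth x i - c)).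
  by rewrite pmulr_rgt0// subr_gt0.
rewrite /g; move: small sgE; set y := _ * _ => /ltr_normlP[yN yP] sgE.
apply/idP/idP; rewrite !inE /= sgE => y0; last by apply: sin_gt0_pi; rewrite y0.
rewrite ltNge; apply/negP => yle; have : 0 <= sin (- y).
  by apply: sin_ge0_pi; rewrite oppr_ge0 yle ltW.
by rewrite sinN oppr_ge0 leNgt y0.
Unshelve. all: by end_near. Qed.

(** Complements and finite unions come from sums and products, countable unions
from the bounded limit of the finite ones. *)
Lemma multiplier_sigma_algebra :
  sigma_algebra setT [set A : set (d.-tuple R) | multiplier (\1_A : _ -> R)].
Proof.
have mU (A B : set (d.-tuple R)) : multiplier (\1_A : _ -> R) ->
    multiplier (\1_B : _ -> R) -> multiplier (\1_(A `|` B) : _ -> R).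
  move=> mA mB; rewrite (_ : \1_(A `|` B) =
    \1_A \+ (\1_B \* (fun x => 1 + (-1) * \1_A x)) :> (_ -> R)).
    exact/multiplierD/multiplierM/multiplier_affine.
  rewrite funeqE => x /=; rewrite !indicE in_setU.
  by case: (_ \in A); case: (_ \in B) => /=; ring.
split=> [|A mA|A mA] /=.
- by rewrite indic0; exact: multiplier_cst.
- rewrite (_ : \1_(_ `\` A) = (fun x => 1 + (-1) * \1_A x)) ?funeqE => [|x].
    exact: multiplier_affine.
  by rewrite setTD !indicE in_setC; case: (_ \in A) => /=; ring.
- apply: (@multiplier_cvg (fun n => \1_(\bigcup_(k < n) A k)) _ 1).
  + elim=> [|n IH]; rewrite bigcup_mkord.
      by rewrite big_ord0 indic0; exact: multiplier_cst.
    rewrite big_ord_recr /= -bigcup_mkord.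
    by apply: mU; [exact: IH | exact: mA].
  + by move=> n x; rewrite indicE ger0_norm// lern1 leq_b1.
  + move=> x; apply: cvg_near_cst.
    have [[k _ Akx]|nAx] := pselect ((\bigcup_k A k) x).
      near=> n; have kn : (k < n)%N by near: n; exact: nbhs_infty_gt.
      by rewrite !indicE !mem_set//; exists k.
    apply: nearW => n; rewrite !indicE !memNset//.
    by apply: contra_not nAx => -[k _ Akx]; exists k.
Unshelve. all: by end_near. Qed.

Lemma multiplier_indic (A : set (d.-tuple R)) :
  measurable A -> multiplier (\1_A : _ -> R).
Proof.
move: A; apply: (@smallest_sub _ _ _ [set A : set (d.-tuple R) |
  multiplier (\1_A : _ -> R)]); first exact: multiplier_sigma_algebra.
rewrite -bigcup_seq => A [i _ [B mB <-]] /=; rewrite setTI.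
have [S0 SC SU] := multiplier_sigma_algebra.
have {}mB : (@RGenOInfty.G R).-sigma.-measurable B.
  by rewrite -RGenOInfty.measurableE; exact: mB.
suff rays : (@RGenOInfty.G R).-sigma.-measurable `<=`
    [set B : set R |
      multiplier (\1_((fun x : d.-tuple R => tnth x i) @^-1` B) : _ -> R)].
  exact: rays mB.
apply: smallest_sub.
- split=> [|C mC|C mC] /=.
  + by rewrite preimage_set0.
  + by rewrite setTD preimage_setC -setTD; exact: SC.
  + by rewrite preimage_bigcup; exact: SU.
- move=> _ [c ->] /=.
  rewrite (_ : _ @^-1` _ = [set x | c < tnth x i]); first exact: multiplier_ray.
  by apply/seteqP; split=> x /=; rewrite in_itv /= andbT.
Qed.

(** Multiplying by [\1_A] keeps the Fourier transforms of [P] and [Q] equal, and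
their values at 0 become [P A] and [Q A]. *)
Lemma same_fourier1_eq : same_fourier (cst 1) ->
  forall A, measurable A -> P A = Q A.
Proof.
move=> f1 A mA.
have [_ /(_ _ f1)[_ /(_ [tuple 0 | i < d] 0)]] := multiplier_indic mA.
have dot0 x : dotR [tuple 0 | i < d] x = 0.
  by rewrite /dotR big1// => i _; rewrite tnth_mktuple mul0r.
have E (S : probability (d.-tuple R) R) : \int[S]_x ((cst 1 \* \1_A) x *
    cos (dotR [tuple 0 | i < d] x + 0)) = fine (S A).
  under eq_Rintegral do rewrite dot0 addr0 cos0 mulr1 /= mul1r.
  by rewrite /Rintegral integral_indic// setIT.
rewrite !E => PQ; rewrite -[LHS]fineK ?fin_num_measure//.
by rewrite -[RHS]fineK ?fin_num_measure// PQ.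
Qed.

End CharacteristicFunction.

(** * Uniqueness of the measure with a given characteristic function *)

Lemma expC_iE (R : realType) (r : R) : expC ('i * r%:C)%C = (cos r +i* sin r)%C.
Proof.
by rewrite /expC /=; simpc; rewrite expR0; simpc.
Qed.

(** [cos (a + t) = cos t cos a - sin t sin a] recovers all phases [t] from the
real and the imaginary part of the characteristic function. *)
Lemma char_fun_unique (R : realType) (d : nat)
    (P Q : probability (d.-tuple R) R) :
  (forall y : d.-tuple R,
    integralC P setT (fun x : d.-tuple R => expC ('i * (dotR y x)%:C)%C) =
    integralC Q setT (fun x : d.-tuple R => expC ('i * (dotR y x)%:C)%C)) ->
  forall A, measurable A -> P A = Q A.
Proof.
move=> PQ; apply: same_fourier1_eq; split=> [|z t].
  exact: bounded_measurable_cst.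
have := PQ z; rewrite /integralC.
have reE (S : probability (d.-tuple R) R) :
    \int[S]_x complex.Re (expC ('i * (dotR z x)%:C)%C) =
    \int[S]_x cos (dotR z x + 0).
  by apply: eq_Rintegral => x _; rewrite expC_iE addr0.
have imE (S : probability (d.-tuple R) R) :
    \int[S]_x complex.Im (expC ('i * (dotR z x)%:C)%C) =
    \int[S]_x cos (dotR z x - pi / 2).
  apply: eq_Rintegral => x _.
  by rewrite expC_iE /= cosB cos_pihalf sin_pihalf; ring.
rewrite !reE !imE => -[cosE sinE].
have E (S : probability (d.-tuple R) R) :
    \int[S]_x (cst 1 x * cos (dotR z x + t)) =
    cos t * \int[S]_x cos (dotR z x + 0) -
    sin t * \int[S]_x cos (dotR z x - pi / 2).
  have int r : S.-integrable setT (EFin \o (fun x => cos (dotR z x + r))).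
    exact: bounded_measurable_integrable (bounded_measurable_cos z r).
  have intZ c r :
      S.-integrable setT (EFin \o (fun x => c * cos (dotR z x + r))).
    exact: bounded_measurable_integrable
      (bounded_measurableM (bounded_measurable_cst c)
        (bounded_measurable_cos z r)).
  rewrite -!RintegralZl//; try exact: int.
  rewrite -RintegralB//; try exact: intZ.
  apply: eq_Rintegral => x _.
  by rewrite mul1r addr0 cosB cos_pihalf sin_pihalf cosD; ring.
by rewrite !E cosE sinE.
Qed.

(** * The image of the Wright measure *)

Lemma bounded_Rintegral_distribution (d1 d2 : measure_display)
    (T1 : measurableType d1) (T2 : measurableType d2) (R : realType)
    (P : probability T1 R) (X : {mfun T1 >-> T2}) (f : T2 -> R) :
  bounded_measurable f ->
  \int[distribution P X]_y f y = \int[P]_x f (X x).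
Proof.
move=> [mf [C fC]]; rewrite /Rintegral integral_distribution//.
  exact/measurable_EFinP.
apply: (@bounded_measurable_integrable _ _ _ _ (f \o X)).
by split; [exact: measurableT_comp | exists C => x; exact: fC].
Qed.

Lemma dotR_pairings (R : realType) (N : nuclear_triple R) (d : nat)
    (phi : 'I_d -> N) (y : d.-tuple R) (omega : dual N) :
  dotR y (pairings phi omega) = omega (\sum_(i < d) tnth y i *: phi i).
Proof.
rewrite linear_sum; apply: eq_bigr => i _.
by rewrite linearZ tnth_mktuple.
Qed.

Lemma innerN_orthonormal (R : realType) (N : nuclear_triple R) (d : nat)
    (phi : 'I_d -> N) (y : d.-tuple R) :
  (forall i j, innerN (phi i) (phi j) = (i == j)%:R) ->
  innerN (\sum_(i < d) tnth y i *: phi i) (\sum_(i < d) tnth y i *: phi i) =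
  dotR y y.
Proof.
move=> hphi; rewrite /innerN (linear_sum (nt_emb N 0)) linear_sumlz.
apply: eq_bigr => i _.
have innerZ j : inner (nt_H N 0) (nt_emb N 0 (tnth y i *: phi i))
    (nt_emb N 0 (tnth y j *: phi j)) = tnth y i * (tnth y j * (i == j)%:R).
  rewrite (linearZ_LR (nt_emb N 0) (tnth y i)).
  rewrite (linearZ_LR (nt_emb N 0) (tnth y j)).
  by rewrite linearZl_LR linearZr_LR /= -hphi.
rewrite linear_sumr (bigD1 i)//= big1 ?addr0 => [|j ji]; rewrite innerZ.
  by rewrite eqxx mulr1.
by rewrite eq_sym (negbTE ji) !mulr0.
Qed.

Theorem lemma3p3 (R : realType) (p m : nat)
  (a alpha : 'I_p -> R) (b beta : 'I_m -> R)
  (halpha : forall i, 0 < alpha i) (haalpha : forall i, 0 < a i + alpha i)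
  (hbeta : forall j, 0 < beta j) (hbbeta : forall j, 0 < b j + beta j)
  (hstar : 0 < fox_astar alpha beta \/
           (fox_astar alpha beta = 0 /\ fox_mu a b < -1))
  (gammaH : R) (hgammaH : foxH_abscissa b beta gammaH)
  (hH : forall tau : R, 0 < tau -> 0 <= foxH a alpha b beta gammaH tau)
  (gammaPsi : R) (hgammaPsi : wright_abscissa b beta gammaPsi)
  (N : nuclear_triple R)
  (mu : probability (dual_cyl N) R)
  (hmu : is_wright_measure a alpha b beta gammaPsi mu)
  (d : nat) (phi : 'I_d -> N)
  (hphi : forall i j, innerN (phi i) (phi j) = (i == j)%:R) :
  is_wright_measure_fd a alpha b beta gammaPsi
    (distribution mu (pairings_cyl phi)) /\
  (forall nu : probability (d.-tuple R) R,
    is_wright_measure_fd a alpha b beta gammaPsi nu ->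
    forall A : set (d.-tuple R), measurable A ->
      distribution mu (pairings_cyl phi) A = nu A).
Proof.
have image_wright : is_wright_measure_fd a alpha b beta gammaPsi
    (distribution mu (pairings_cyl phi)).
  move=> y; rewrite -(innerN_orthonormal y hphi) -hmu /integralC.
  have bcos : bounded_measurable (fun x : d.-tuple R => cos (dotR y x)).
    have := bounded_measurable_cos y 0.
    by under eq_fun do rewrite addr0.
  have bsin : bounded_measurable (fun x : d.-tuple R => sin (dotR y x)).
    have := bounded_measurable_cos y (- (pi / 2)).
    by under eq_fun do rewrite cosB cos_pihalf sin_pihalf mulr0 mulr1 add0r.
  congr (_ +i* _)%C.
  - under eq_Rintegral do rewrite expC_iE.
    rewrite bounded_Rintegral_distribution//; apply: eq_Rintegral => omega _.
    by rewrite expC_iE [dotR _ _]dotR_pairings.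
  - under eq_Rintegral do rewrite expC_iE.
    rewrite bounded_Rintegral_distribution//; apply: eq_Rintegral => omega _.
    by rewrite expC_iE [dotR _ _]dotR_pairings.
split=> // nu nu_wright; apply: char_fun_unique => y.
by rewrite image_wright nu_wright.
Qed.
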